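(* Let $k\ge 1$ and $n\ge k+1$ be integers, let $Z$ be a real $n\times(k+1)$ matrix of full rank $k+1$, and let $\tilde Z:\mathrm{Gr}(k,n)\dashrightarrow \mathrm{Gr}(k,k+1)$ be the rational map $[A]\mapsto[AZ]$. Suppose that $\tilde Z$ is well-defined on $\mathrm{Gr}_{\ge 0}(k,n)$, i.e. $AZ$ has rank $k$ for every $k\times n$ matrix $A$ representing a point of $\mathrm{Gr}_{\geq 0}(k,n)$. Then, identifying $\mathrm{Gr}(k,k+1)$ with $\mathbb{P}^k$ via the Plücker embedding, the Grasstope $\mathcal{G}_{n,k,1}(Z)=\tilde Z(\mathrm{Gr}_{\ge 0}(k,n))$ satisfies $$\mathcal{G}_{n,k,1}(Z)=\{\mathbf{x}\in\mathbb{P}^k : \overline{\mathrm{var}}(L(\mathbf{x}))\ge k\},$$ where $L(\mathbf{x})$ is the vector of twistor coordinates of $\mathbf{x}$ with respect to $Z$.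
   Context: $\mathrm{Gr}(k,n)$ is the real Grassmannian of $k$-dimensional subspaces of $\mathbb{R}^n$; a point is written $[A]$, the row span of a $k\times n$ matrix $A$ of rank $k$. The Plücker coordinates of $[A]$ are the maximal minors of $A$, up to common scaling. $\mathrm{Gr}_{\ge0}(k,n)\subset \mathrm{Gr}(k,n)$ is the set of points whose nonzero Plücker coordinates all have the same sign. Identification $\mathrm{Gr}(k,k+1)\cong\mathbb{P}^k$: a hyperplane $X=\mathrm{Span}\{w_1,\dots,w_k\}\subset\mathbb{R}^{k+1}$ corresponds to the point $\mathbf{x}\in\mathbb{P}^k$ whose homogeneous coordinates are its Plücker coordinates $p_{1\cdots\hat{j}\cdots k+1}$, $j=1,\dots,k+1$ (the $k\times k$ minors of the matrix with rows $w_1,\dots,w_k$, omitting column $j$); every point of $\mathbb{P}^k$ arises this way from a unique $X$. Twistor coordinates: for $v\in\mathbb{R}^{k+1}$ put $T(\mathbf{x},v)=\det[w_1\,|\cdots|\,w_k\,|\,v]=\sum_{j=1}^{k+1}(-1)^{k+1-j}p_{1\cdots\hat{j}\cdots k+1}\,v_j$. Let $Z_1,\dots,Z_n$ be the rows of $Z$ and $l_i(\mathbf{x})=T(\mathbf{x},Z_i)$. Then $L(\mathbf{x})=(l_1(\mathbf{x}):\dots:l_n(\mathbf{x}))\in\mathbb{P}^{n-1}$. Sign variation: for $v\in\mathbb{R}^n$, $\mathrm{var}(v)$ is the number of sign changes in the sequence $v_1,\dots,v_n$, ignoring zeros, and $\overline{\mathrm{var}}(v)=\max\{\mathrm{var}(w):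 w\in\mathbb{R}^n,\ w_i=v_i \text{ for all } i \text{ with } v_i\ne0\}$. Both are invariant under nonzero scaling of $v$. *)

(* Defs.v *)
From mathcomp Require Import all_boot all_order all_algebra.
From mathcomp Require Import boolp classical_sets reals.

Set Implicit Arguments.
Unset Strict Implicit.
Unset Printing Implicit Defensive.

Import Order.TTheory GRing.Theory Num.Theory.
Local Open Scope ring_scope.
Local Open Scope classical_set_scope.

Definition rowspan (F : fieldType) (m n : nat) (A : 'M[F]_(m, n)) :
    {vspace 'rV[F]_n} :=
  <<[tuple row i A | i < m]>>%VS.

Definition Gr (F : fieldType) (k n : nat) : Type :=
  {V : {vspace 'rV[F]_n} | \dim V == k}.

(* Since [\dim (val V) = k], a k x n matrix with row span V has rank k. *)
Definition represents (F : fieldType) (k n : nat)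
    (A : 'M[F]_(k, n)) (V : Gr F k n) : Prop :=
  rowspan A = val V.

Definition increasing (k n : nat) (f : 'I_k -> 'I_n) : Prop :=
  {homo f : i j / (i < j)%N}.

(* Maximal minors are indexed by strictly increasing maps 'I_k -> 'I_n
   rather than by k-element subsets of 'I_n. *)
Definition plucker (F : fieldType) (k n : nat)
    (A : 'M[F]_(k, n)) (f : 'I_k -> 'I_n) : F :=
  \det (colsub f A).

Definition same_sign_minors (R : realType) (k n : nat)
    (A : 'M[R]_(k, n)) : Prop :=
  forall f g : 'I_k -> 'I_n, increasing f -> increasing g ->
    plucker A f != 0 -> plucker A g != 0 ->
    Num.sg (plucker A f) = Num.sg (plucker A g).

Definition Gr_ge0 (R : realType) (k n : nat) : set (Gr R k n) :=
  [set V | exists2 A : 'M[R]_(k, n), represents A V & same_sign_minors A].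

Definition proj (F : fieldType) (k : nat) : Type := Gr F 1 k.+1.

(* [proj F k] is P^k, the set of lines of F^(k+1); a point x gets as
   homogeneous coordinates a chosen nonzero vector of the line x. *)
Definition hcoord (F : fieldType) (k : nat) (x : proj F k) : 'rV[F]_k.+1 :=
  vpick (val x).

Lemma hcoordP (F : fieldType) (k : nat) (x : proj F k) :
  hcoord x != 0 /\ val x = <[hcoord x]>%VS.
Proof.
have x1 : \dim (val x) = 1%N := eqP (valP x).
have h0 : hcoord x != 0 by rewrite vpick0 -dimv_eq0 x1.
split=> //; apply/esym/eqP; rewrite eqEdim dim_vline h0 x1 leqnn andbT.
by rewrite -memvE memv_pick.
Qed.

(* The j-th entry is the minor omitting column j, without sign. *)
Definition hat_minors (F : fieldType) (k : nat) (W : 'M[F]_(k, k.+1)) :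
    'rV[F]_k.+1 :=
  \row_(j < k.+1) plucker W (@lift k.+1 j).

Definition basis_mx (F : fieldType) (k n : nat) (V : Gr F k n) :
    'M[F]_(k, n) :=
  \matrix_(i < k) (vbasis (val V))`_i.

(* With 0-based j, the sign (-1)^(k+1-j) of the 1-based formula is
   (-1)^(k-j). *)
Definition twistor (F : fieldType) (k : nat) (p v : 'rV[F]_k.+1) : F :=
  \sum_(j < k.+1) (-1) ^+ (k - j) * p 0 j * v 0 j.

Definition append_row (F : fieldType) (k : nat) (W : 'M[F]_(k, k.+1))
    (v : 'rV[F]_k.+1) : 'M[F]_k.+1 :=
  \matrix_(i, j) if unlift ord_max i is Some i' then W i' j else v 0 j.

Lemma twistor_det (F : fieldType) (k : nat) (W : 'M[F]_(k, k.+1))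
    (v : 'rV[F]_k.+1) :
  twistor (hat_minors W) v = \det (append_row W v).
Proof.
rewrite (expand_det_row _ ord_max); apply: eq_bigr => j _.
rewrite /cofactor !mxE unlift_none /plucker mulrC; congr (_ * _).
have jk : (j <= k)%N by rewrite -ltnS.
have -> : (-1) ^+ (k - j) = (-1) ^+ (k + j) :> F.
  by rewrite -signr_odd oddB // -oddD signr_odd.
congr (_ * _); congr (\det _).
by apply/matrixP => a b; rewrite !mxE liftK.
Qed.

Lemma mem_rowspan (F : fieldType) (m n : nat) (A : 'M[F]_(m, n))
    (v : 'rV[F]_n) :
  (v \in rowspan A) = (v <= A)%MS.
Proof.
apply/idP/submxP => [vA | [D ->]].
  exists (\row_i coord [tuple row i A | i < m] i v).
  rewrite mulmx_sum_row {1}(coord_span vA).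
  by apply: eq_bigr => i _; rewrite mxE -tnth_nth tnth_mktuple.
rewrite mulmx_sum_row memv_suml // => i _; apply/memvZ/memv_span.
by apply/tnthP; exists i; rewrite tnth_mktuple.
Qed.

Lemma dim_rowspan (F : fieldType) (m n : nat) (A : 'M[F]_(m, n)) :
  \dim (rowspan A) = \rank A.
Proof.
have eqA : rowspan A = rowspan (row_base A).
  by apply/vspaceP => v; rewrite !mem_rowspan eq_row_base.
rewrite eqA; set X := [tuple row i (row_base A) | i < \rank A].
apply: (@size_basis _ _ _ _ X); rewrite basisEfree subvv size_tuple.
rewrite (leq_trans (dim_span _)) ?size_tuple //.
rewrite !andbT; apply: (introT (@freeP _ _ _ X)) => c c0 i.
suff c1 : \row_i c i = 0 by have /rowP/(_ i) := c1; rewrite !mxE.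
apply: (row_free_inj (row_base_free A)); rewrite mul0mx mulmx_sum_row -[RHS]c0.
by apply: eq_bigr => j _; rewrite mxE -tnth_nth tnth_mktuple.
Qed.

Lemma basis_mxP (F : fieldType) (k n : nat) (V : Gr F k n) :
  represents (basis_mx V) V.
Proof.
rewrite /represents -[RHS](span_basis (vbasisP (val V))); congr span.
have dV : \dim (val V) = k := eqP (valP V).
apply: (@eq_from_nth _ 0) => [|i]; rewrite !size_tuple ?dV // => ik.
by rewrite -(tnth_nth 0 _ (Ordinal ik)) tnth_mktuple rowK.
Qed.

Lemma rank_basis_mx (F : fieldType) (k n : nat) (V : Gr F k n) :
  \rank (basis_mx V) = k.
Proof. by rewrite -dim_rowspan basis_mxP (eqP (valP V)). Qed.

Lemma hat_minors_neq0 (F : fieldType) (k : nat) (W : 'M[F]_(k, k.+1)) :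
  \rank W = k -> hat_minors W != 0.
Proof.
move=> rW; apply/eqP => W0.
have /row_subPn[i viW] : ~~ ((1%:M : 'M[F]_k.+1) <= W)%MS.
  by apply/negP => /mxrankS; rewrite mxrank1 rW ltnn.
set v := row i _ in viW.
have : \det (append_row W v) = 0.
  by rewrite -twistor_det W0 /twistor big1 // => j _; rewrite mxE mulr0 mul0r.
move/eqP/det0P => [u u0 uM].
pose u' : 'rV[F]_k := \row_a u 0 (lift ord_max a).
have u'E a : u' 0 a = u 0 (lift ord_max a) by rewrite mxE.
have eW : u *m append_row W v = u' *m W + u 0 ord_max *: v.
  rewrite mulmx_sum_row big_ord_recr /= mulmx_sum_row; congr (_ + _ *: _).
    apply: eq_bigr => a _; rewrite u'E.
    have -> : widen_ord (leqnSn k) a = lift ord_max a.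
      by apply: val_inj; rewrite /= /bump leqNgt ltn_ord.
    suff -> : row (lift ord_max a) (append_row W v) = row a W by [].
    by apply/rowP => b; rewrite !mxE liftK.
  by apply/rowP => b; rewrite 2!mxE unlift_none.
rewrite eW in uM.
have [um|um] := eqVneq (u 0 ord_max) 0; last first.
  case/negP: viW; move/eqP: uM; rewrite addrC addr_eq0 => /eqP uM.
  by rewrite -(eqmx_scale v um) uM -mulNmx submxMl.
move: uM; rewrite um scale0r addr0 => uM.
have rfW : row_free W by rewrite /row_free rW.
have u'0 : u' = 0.
  by apply: (row_free_inj rfW); rewrite uM mul0mx.
case/negP: u0; apply/eqP/rowP => j; rewrite [RHS]mxE.
case: (unliftP ord_max j) => [a ->|-> //].
by rewrite -u'E u'0 mxE.
Qed.

Lemma Gr_plucker_subproof (F : fieldType) (k : nat) (X : Gr F k k.+1) :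
  \dim <[hat_minors (basis_mx X)]> == 1.
Proof. by rewrite dim_vline hat_minors_neq0 ?rank_basis_mx. Qed.

(* Independent of the chosen basis of X: see [Gr_pluckerE]. *)
Definition Gr_plucker (F : fieldType) (k : nat) (X : Gr F k k.+1) :
    proj F k :=
  exist _ <[hat_minors (basis_mx X)]>%VS (Gr_plucker_subproof X).

Lemma pluckerM (F : fieldType) (k n : nat) (B : 'M[F]_k) (A : 'M[F]_(k, n))
    (f : 'I_k -> 'I_n) :
  plucker (B *m A) f = \det B * plucker A f.
Proof. by rewrite /plucker -mulmx_colsub det_mulmx. Qed.

Lemma represents_rank (F : fieldType) (k n : nat) (A : 'M[F]_(k, n))
    (V : Gr F k n) :
  represents A V -> \rank A = k.
Proof. by move=> AV; rewrite -dim_rowspan AV (eqP (valP V)). Qed.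

Lemma represents_unit (F : fieldType) (k n : nat) (A A' : 'M[F]_(k, n))
    (V : Gr F k n) :
  represents A V -> represents A' V -> exists2 B, B \in unitmx & A' = B *m A.
Proof.
move=> AV A'V.
have /submxP[B A'B] : (A' <= A)%MS.
  apply/row_subP => i; rewrite -mem_rowspan AV -A'V mem_rowspan.
  exact: row_sub.
exists B => //; rewrite -row_full_unit /row_full eqn_leq rank_leq_row /=.
by rewrite -{1}(represents_rank A'V) A'B mxrankM_maxl.
Qed.

Lemma Gr_pluckerE (F : fieldType) (k : nat) (X : Gr F k k.+1)
    (W : 'M[F]_(k, k.+1)) :
  represents W X -> val (Gr_plucker X) = <[hat_minors W]>%VS.
Proof.
move=> WX; have [B Bu ->] := represents_unit (basis_mxP X) WX.
have -> : hat_minors (B *m basis_mx X) = \det B *: hat_minors (basis_mx X).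
  by apply/rowP => j; rewrite !mxE pluckerM.
have dB : \det B != 0 by rewrite -unitfE -unitmxE.
apply/eqP; rewrite eqEsubv -!memvE /= memvZ ?memv_line // andbT.
by apply/vlineP; exists (\det B)^-1; rewrite scalerA mulVf ?scale1r.
Qed.

Lemma Gr_ge0E (R : realType) (k n : nat) (V : Gr R k n) (A : 'M[R]_(k, n)) :
  represents A V -> Gr_ge0 V <-> same_sign_minors A.
Proof.
move=> AV; split=> [[B BV sB] | sA]; last by exists A.
have [C Cu ->] := represents_unit BV AV.
have dC : \det C != 0 by rewrite -unitfE -unitmxE.
move=> f g fi gi; rewrite !pluckerM !mulf_eq0 !negb_or !sgrM.
by move=> /andP[_ f0] /andP[_ g0]; rewrite (sB f g).
Qed.

(* A rational map is only partially defined, so it is given by its graph. *)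
Definition Zmap (R : realType) (k n : nat) (Z : 'M[R]_(n, k.+1))
    (V : Gr R k n) (X : Gr R k k.+1) : Prop :=
  exists2 A : 'M[R]_(k, n), represents A V & represents (A *m Z) X.

Definition Zmap_well_defined (R : realType) (k n : nat)
    (Z : 'M[R]_(n, k.+1)) : Prop :=
  forall V : Gr R k n, Gr_ge0 V ->
    forall A : 'M[R]_(k, n), represents A V -> \rank (A *m Z) = k.

Definition grasstope (R : realType) (k n : nat) (Z : 'M[R]_(n, k.+1)) :
    set (Gr R k k.+1) :=
  [set X | exists2 V : Gr R k n, Gr_ge0 V & Zmap Z V X].

Definition twistor_vec (R : realType) (k n : nat) (Z : 'M[R]_(n, k.+1))
    (x : proj R k) : 'rV[R]_n :=
  \row_i twistor (hcoord x) (row i Z).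

Definition var_seq (R : realType) (s : seq R) : nat :=
  let t := [seq a <- s | a != 0] in
  count (fun p : R * R => p.1 * p.2 < 0) (zip t (behead t)).

Definition var (R : realType) (n : nat) (v : 'rV[R]_n) : nat :=
  var_seq [seq v 0 i | i <- enum 'I_n].

Definition agrees_on_support (R : realType) (n : nat) (v w : 'rV[R]_n) :
    Prop :=
  forall i, v 0 i != 0 -> w 0 i = v 0 i.

(* The bound [m < n.+1] is harmless, as [var w <= n]; see [var_barP]. *)
Definition var_bar (R : realType) (n : nat) (v : 'rV[R]_n) : nat :=
  \max_(m < n.+1 | `[< exists2 w, agrees_on_support v w & var w = m >]) m.

Lemma var_leq (R : realType) (n : nat) (v : 'rV[R]_n) : (var v <= n)%N.
Proof.
apply: leq_trans (count_size _ _) _.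
rewrite size_zip (leq_trans (geq_minl _ _)) // size_filter.
by rewrite (leq_trans (count_size _ _)) // size_map size_enum_ord.
Qed.

Lemma var_barP (R : realType) (n : nat) (v : 'rV[R]_n) :
  (exists2 w, agrees_on_support v w & var w = var_bar v) /\
  (forall w, agrees_on_support v w -> (var w <= var_bar v)%N).
Proof.
split=> [|w vw]; last first.
  have wn : (var w < n.+1)%N by rewrite ltnS var_leq.
  by apply: (bigop.bigmax_sup (Ordinal wn)) => //; apply/asboolP; exists w.
have vn : (var v < n.+1)%N by rewrite ltnS var_leq.
rewrite /var_bar (bigop.bigmax_eq_arg (Ordinal vn)); last by apply/asboolP; exists v.
by case: arg_maxnP => [|m /asboolP //]; apply/asboolP; exists v.
Qed.

Lemma varZ (R : realType) (n : nat) (c : R) (v : 'rV[R]_n) :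
  c != 0 -> var (c *: v) = var v.
Proof.
move=> c0; rewrite /var.
have -> : [seq (c *: v) 0 i | i <- enum 'I_n] =
    [seq c * a | a <- [seq v 0 i | i <- enum 'I_n]].
  by rewrite -[RHS]map_comp; apply: eq_map => i; rewrite /= mxE.
rewrite /var_seq filter_map.
rewrite (eq_filter (a2 := fun a => a != 0)) => [|a]; last first.
  by rewrite /= mulf_eq0 (negPf c0).
rewrite behead_map.
have zip_map (s t : seq R) : zip (map ( *%R c) s) (map ( *%R c) t) =
    [seq (c * p.1, c * p.2) | p <- zip s t].
  by elim: s t => [|a s IH] [|b t] //=; rewrite IH.
rewrite zip_map count_map; apply: eq_count => p /=.
by rewrite mulrACA pmulr_rlt0 // -expr2 exprn_even_gt0 //= c0.
Qed.

Lemma var_barZ (R : realType) (n : nat) (c : R) (v : 'rV[R]_n) :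
  c != 0 -> var_bar (c *: v) = var_bar v.
Proof.
suff le_var d (u : 'rV[R]_n) : d != 0 -> (var_bar u <= var_bar (d *: u))%N.
  move=> c0; apply/eqP; rewrite eqn_leq le_var // andbT.
  have := le_var c^-1 (c *: v); rewrite scalerA mulVf // scale1r invr_eq0.
  exact.
move=> d0; have [[w uw <-] _] := var_barP u; rewrite -(varZ w d0).
apply: (var_barP (d *: u)).2 => i; rewrite !mxE mulf_eq0 negb_or.
by case/andP=> _ /uw ->.
Qed.

(* Main.v *)
(* The twistor vector L of a hyperplane X = [AZ] satisfies A L = 0, so the theorem
   is a statement about the vectors annihilated by a point of Gr_{>=0}(k,n).

   If A has nonnegative maximal minors, A v = 0 and v <> 0, then some vector with
   the signs of v on its support has at least k sign changes.  Adding a small multiple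
   of a column to an adjacent one (and correcting v) keeps the minors nonnegative,
   never makes a nonzero minor or entry vanish, and can always be used to turn
   a zero minor, or a zero entry of v, into a nonzero one.  This reduces to the case
   where all minors are positive and v has full support.  There, if v had fewer than k sign
   changes, one could group the columns of A, weighted by |v_i|, into k consecutive
   blocks on which v has constant sign; by multilinearity the resulting k x k
   determinant is positive, whereas A v = 0 is a linear dependence of its columns.

   Conversely, if v alternates weakly along k + 1 indices, take any basis of the
   hyperplane of R^(k+1) orthogonal to the restriction of v to these indices. *)

Require Import Defs.
From mathcomp Require Import all_boot all_order all_algebra perm.
From mathcomp Require Import boolp classical_sets reals.
From mathcomp Require Import zify ring lra.

Set Implicit Arguments.
Unset Strict Implicit.
Unset Printing Implicit Defensive.

Import Order.TTheory GRing.Theory Num.Theory.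
Local Open Scope ring_scope.
Local Open Scope classical_set_scope.

(** * Increasing maps and minors *)

Definition ltord (n : nat) : rel 'I_n := relpre val ltn.

Lemma sorted_enum_ord (n : nat) : sorted (@ltord n) (enum 'I_n).
Proof. by rewrite -sorted_map val_enum_ord iota_ltn_sorted. Qed.

Lemma ltord_trans (n : nat) : transitive (@ltord n).
Proof. by move=> j i l; apply: ltn_trans. Qed.

Lemma increasing_tnth (n k : nat) (t : k.-tuple 'I_n) :
  sorted (@ltord n) t -> increasing (tnth t).
Proof.
move=> st i j ij; have [x0 _] : {x0 : 'I_n | true} by exists (tnth t i).
rewrite !(tnth_nth x0).
by apply: (sorted_ltn_nth (@ltord_trans n)) => //; rewrite inE size_tuple ltn_ord.
Qed.

Lemma increasing_inj (k n : nat) (f : 'I_k -> 'I_n) :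
  increasing f -> injective f.
Proof.
move=> fi i j fij; apply/val_inj; case: (ltngtP i j) => // /fi;
by rewrite fij ltnn.
Qed.

Lemma increasing_ge (k n : nat) (f : 'I_k -> 'I_n) (i : 'I_k) :
  increasing f -> (i <= f i)%N.
Proof.
move=> fi; case: i => i; elim: i => [|i IH] // lik.
have lik' := ltnW lik.
by apply: leq_ltn_trans (IH lik') _; apply: fi => /=.
Qed.

Lemma increasing_id (k : nat) (f : 'I_k -> 'I_k) : increasing f -> f =1 id.
Proof.
move=> fi i; apply/val_inj/eqP; rewrite /= eqn_leq increasing_ge // andbT.
(* Conjugating by the order reversal turns [increasing_ge] for [g] into the upper bound
   [f i <= i]. *)
pose g i := rev_ord (f (rev_ord i)).
have gi : increasing g.
  move=> a b ab; rewrite /g /=.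
  have /fi : (rev_ord b < rev_ord a)%N by rewrite /=; have := ltn_ord b; lia.
  by have := ltn_ord (f (rev_ord a)); lia.
have := increasing_ge (rev_ord i) gi; rewrite /g rev_ordK /=.
by have := ltn_ord (f i); have := ltn_ord i; lia.
Qed.

(** By counting, [f] misses some [j]; deleting [j] from the codomain leaves an increasing self-map
    of ['I_k], hence the identity. This matches the maximal minors of a k x (k+1) matrix with the
    entries of [hat_minors]. *)
Lemma increasing_lift (k : nat) (f : 'I_k -> 'I_k.+1) :
  increasing f -> exists j, f =1 @lift k.+1 j.
Proof.
move=> fi.
have [j jf] : exists j, j \notin codom f.
  apply/existsP; rewrite -negb_forall; apply/negP => /forallP fs.
  have : (#|'I_k.+1| <= #|codom f|)%N.
    by apply/subset_leq_card/fintype.subsetP => x _; exact: fs.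
  by rewrite (card_codom (increasing_inj fi)) !card_ord ltnn.
have fj i : j != f i by apply: contraNneq jf => ->; apply: codom_f.
pose g i := odflt i (unlift j (f i)).
have gE i : lift j (g i) = f i.
  by rewrite /g; have [x ->] := unlift_some (fj i); move=> ->.
exists j => i; rewrite -gE (@increasing_id _ g) // => a b /fi.
by rewrite -!gE /= /bump; lia.
Qed.

(** Cauchy-Binet before grouping terms by image: each column of the product is a combination of
    columns of [A], and the determinant is expanded multilinearly. *)
Lemma det_mulmx_rect (F : fieldType) (k n : nat)
    (A : 'M[F]_(k, n)) (B : 'M[F]_(n, k)) :
  \det (A *m B) =
    \sum_(f : {ffun 'I_k -> 'I_n}) (\prod_j B (f j) j) * plucker A f.
Proof.
rewrite -det_tr trmx_mul /determinant.
transitivity (\sum_(s : 'S_k) \sum_(f : {ffun 'I_k -> 'I_n})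
   (-1) ^+ s * \prod_j (B (f j) j * A (s j) (f j))).
  apply: eq_bigr => s _; rewrite -big_distrr /=; congr (_ * _).
  rewrite -(bigA_distr_bigA (fun (j : 'I_k) (l : 'I_n) => B l j * A (s j) l)) /=.
  by apply: eq_bigr => j _; rewrite mxE; apply: eq_bigr => l _; rewrite !mxE.
rewrite exchange_big; apply: eq_bigr => f _ /=.
rewrite /plucker -det_tr big_distrr /=; apply: eq_bigr => s _.
rewrite mulrCA big_split //=; congr (_ * (_ * _)).
by apply: eq_bigr => j _; rewrite !mxE.
Qed.

(** [maxrankfun] selects [k] independent columns in no prescribed order; filtering [enum 'I_n] by
    its image sorts them. *)
Lemma ex_increasing_plucker_neq0 (F : fieldType) (k n : nat) (A : 'M[F]_(k, n)) :
  \rank A = k -> exists2 f, increasing f & plucker A f != 0.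
Proof.
move=> rA; pose g := maxrankfun A^T.
pose S := [seq i <- enum 'I_n | i \in codom g].
have Sk : size S == k.
  have -> : S = enum (mem (codom g)).
    by rewrite /S enumT.
  rewrite -cardE (card_codom (@maxrankfun_inj _ _ _ A^T)) card_ord.
  by rewrite mxrank_tr rA.
pose t := Tuple Sk.
exists (tnth t).
  apply/increasing_tnth/sorted_filter; first exact: ltord_trans.
  exact: sorted_enum_ord.
rewrite /plucker -det_tr -unitfE -unitmxE -row_full_unit /row_full.
rewrite trmx_mxsub eqn_leq rank_leq_row /= -{1}rA -mxrank_tr -eq_maxrowsub.
apply/mxrankS/row_subP => b; rewrite row_rowsub.
have /tnthP[a ->] : g b \in t by rewrite mem_filter codom_f mem_enum.
by apply: (eq_row_sub a); rewrite row_rowsub.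
Qed.

(** * Positive minors and full support *)

Definition opposite_signs (R : numDomainType) : rel R := fun x y => x * y < 0.

Lemma var_full_support (R : realType) (n : nat) (v : 'rV[R]_n)
    (s := [seq v 0 i | i <- enum 'I_n]) :
  (forall i, v 0 i != 0) ->
  var v = count (fun p => opposite_signs p.1 p.2) (zip s (behead s)).
Proof.
move=> v0; rewrite /var /var_seq -/s.
by have /all_filterP -> : all (fun a => a != 0) s by apply/allP => _ /mapP[i _ ->].
Qed.

Lemma nat_ivt (B : nat -> nat) (N j : nat) :
  B 0%N = 0%N -> (forall t, (B t.+1 <= (B t).+1)%N) -> (j <= B N)%N ->
  exists2 t, (t <= N)%N & B t = j.
Proof.
move=> B0 B1 jN; have ex : exists t, (j <= B t)%N by exists N.
case: (ex_minnP ex) => t jt tmin; exists t; first exact: tmin.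
case: t jt tmin => [|t] jt tmin; first by move: jt; rewrite B0; lia.
have := B1 t; have : ~~ (j <= B t)%N by apply/negP => /tmin; rewrite ltnn.
lia.
Qed.

(* Cutting at the sign changes may give fewer than [k] blocks; the maximum with
   [i - (n - k)] cuts the tail further, into single entries. *)
Lemma sign_blocks (R : realType) (k n : nat) (v : 'rV[R]_n) :
  (k <= n)%N -> (forall i, v 0 i != 0) -> (var v < k)%N ->
  exists b : 'I_n -> 'I_k,
    [/\ {homo b : i j / (i <= j)%N}, (forall j, exists i, b i = j) &
        forall i j, b i = b j -> Num.sg (v 0 i) = Num.sg (v 0 j)].
Proof.
move=> kn v0; rewrite var_full_support //.
set s := [seq _ | _ <- _]; set P := fun p : R * R => _; set z := zip _ _ => vk.
have n0 : (0 < n)%N by lia.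
have ss : size s = n by rewrite size_map size_enum_ord.
have sz : size z = n.-1 by rewrite size_zip size_behead ss; lia.
have sE (i : 'I_n) : s`_i = v 0 i.
  by rewrite (nth_map i) ?size_enum_ord // nth_ord_enum.
have sn0 t : (t < n)%N -> s`_t != 0 by move=> tn; rewrite (sE (Ordinal tn)).
(* [c t] counts the sign changes up to position [t]. *)
pose c t := count P (take t z).
have cS t : (t.+1 < n)%N -> c t.+1 = (c t + (s`_t * s`_t.+1 < 0)%R)%N.
  move=> tn; rewrite /c (take_nth (0, 0)) ?sz; last by lia.
  rewrite -cats1 count_cat /= addn0 nth_zip_cond -/z sz.
  have -> : (t < n.-1)%N by lia.
  by rewrite /P /= /opposite_signs nth_behead.
have cS' t : (c t <= c t.+1 <= (c t).+1)%N.
  have [tn|tn] := ltnP t.+1 n.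
    by rewrite cS //; case: (_ < 0); lia.
  by rewrite /c !take_oversize ?sz //; lia.
have ck t : (c t < k)%N.
  apply: leq_ltn_trans vk; rewrite -[in leqRHS](cat_take_drop t z).
  by rewrite count_cat leq_addr.
(* The truncated difference is 0 at [t = 0] and [k - 1] at [t = n - 1], so [B], rising by at most
   one per step, takes every value below [k]. *)
pose B t := maxn (c t) (t + k - n).
have B0 : B 0%N = 0%N by rewrite /B /c take0 /=; lia.
have BS t : (B t <= B t.+1 <= (B t).+1)%N.
  by have := cS' t; rewrite /B; lia.
have Bk t : (t < n)%N -> (B t < k)%N by have := ck t; rewrite /B; lia.
have Bmon t u : (t <= u)%N -> (B t <= B u)%N.
  by apply: (homo_leq leqnn leq_trans) => i; case/andP: (BS i).
have Bsg t u : (t <= u)%N -> (u < n)%N -> B t = B u -> 0 < s`_t * s`_u.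
  elim: u => [|u IH] tu un BB.
    have -> : t = 0%N by lia.
    by rewrite -expr2 exprn_even_gt0 ?sn0.
  move: tu; rewrite leq_eqVlt => /predU1P[->|tu].
    by rewrite -expr2 exprn_even_gt0 ?sn0.
  have Bu : B t = B u.
    by have := Bmon t u tu; have := BS u; lia.
  have := IH tu (ltnW un) Bu.
  (* A sign change here would raise [c], hence also [B]: where the other term of the maximum
     dominates strictly, it is positive and grows by one as well. *)
  have : ~~ (s`_u * s`_u.+1 < 0).
    apply/negP => lt0; have := cS u un; rewrite lt0.
    by move: (BS u) Bu BB; rewrite /B; lia.
  rewrite -leNgt => le1 lt1.
  have : 0 < s`_u * s`_u.+1.
    by rewrite lt0r le1 mulf_neq0 ?sn0 // ltnW.
  move=> lt2; have := mulr_gt0 lt1 lt2.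
  have -> : s`_t * s`_u * (s`_u * s`_u.+1) = s`_u ^+ 2 * (s`_t * s`_u.+1) by ring.
  by rewrite pmulr_rgt0 // exprn_even_gt0 ?sn0 // ltnW.
exists (fun i : 'I_n => Ordinal (Bk i (ltn_ord i))); split.
- by move=> i j /Bmon.
- move=> j; have [|t tn Bt] := @nat_ivt B n.-1 j B0 (fun t => proj2 (andP (BS t))).
    by have := ltn_ord j; rewrite /B; lia.
  have tn' : (t < n)%N by lia.
  by exists (Ordinal tn'); apply/val_inj.
have sg_eq (x y : R) : 0 < x * y -> Num.sg x = Num.sg y.
  rewrite -sgr_cp0 sgrM; do 2!case: sgrP => _;
  by rewrite ?(mulr0, mul0r, mul1r, mulr1, mulN1r, opprK) // => /eqP; lra.
move=> i j [Bij]; case: (leqP i j) => ij.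
  by apply: sg_eq; rewrite -!sE; apply: Bsg.
by apply/esym/sg_eq; rewrite -!sE; apply: Bsg => //; apply: ltnW.
Qed.

Lemma full_support_positive_minors (R : realType) (k n : nat)
    (A : 'M[R]_(k, n)) (s : R) (v : 'rV[R]_n) :
  (k <= n)%N -> (forall f, increasing f -> 0 < s * plucker A f) ->
  (forall i, v 0 i != 0) -> v *m A^T = 0 -> (k <= var v)%N.
Proof.
move=> kn A0 v0 vA; rewrite leqNgt; apply/negP => vk.
have [b [bmon bsurj bsg]] := sign_blocks kn v0 vk.
have k0 : (0 < k)%N by lia.
have [g0 g0E] := boolp.choice bsurj.
pose g : {ffun 'I_k -> 'I_n} := finfun g0.
have gE j : b (g j) = j by rewrite ffunE.
(* Column [j] of [A *m D] is the weighted sum of the columns of [A] in block [j]. *)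
pose D : 'M[R]_(n, k) := \matrix_(i, j) (`|v 0 i| *+ (b i == j)).
have secP (f : 'I_k -> 'I_n) : (forall j, b (f j) = j) -> increasing f.
  move=> bf i j ij; rewrite ltnNge; apply/negP => /bmon; rewrite !bf.
  by rewrite leqNgt ij.
(* Only sections of [b] contribute to the expansion. They are increasing, so their terms are
   nonnegative, and that of [g] is positive. *)
have detAD : 0 < s * \det (A *m D).
  rewrite det_mulmx_rect mulr_sumr (bigD1 g) //=; apply: ltr_pwDl.
    rewrite mulrCA mulr_gt0 ?A0 //; last exact: secP.
    by apply: prodr_gt0 => j _; rewrite mxE gE eqxx normr_gt0.
  apply: sumr_ge0 => f _.
  have [/forallP bf|] := boolP [forall j, b (f j) == j].
    rewrite mulrCA mulr_ge0 //.
      by apply: prodr_ge0 => j _; rewrite mxE mulrn_wge0.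
    by apply/ltW/A0/secP => j; apply/eqP.
  rewrite negb_forall => /existsP[j bfj].
  by rewrite (bigD1 j) //= mxE (negPf bfj) !mul0r mulr0.
(* The signs of [v] on the blocks undo the absolute values in [D], so [e] is a dependence among the
   columns of [A *m D]. *)
pose e : 'rV[R]_k := \row_j Num.sg (v 0 (g j)).
have eD : e *m D^T = v.
  apply/rowP => i; rewrite mxE (bigD1 (b i)) //= big1 => [|j jb].
    by rewrite addr0 !mxE eqxx (bsg (g (b i)) i) ?gE // -numEsg.
  by rewrite !mxE eq_sym (negPf jb) mulr0.
have : \det (A *m D) = 0.
  apply/eqP; rewrite -det_tr; apply/det0P; exists e.
    by apply/rV0Pn; exists (Ordinal k0); rewrite mxE sgr_eq0.
  by rewrite trmx_mul mulmxA eD.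
by move=> d0; move: detAD; rewrite d0 mulr0 ltxx.
Qed.

(** * Perturbation to positive minors *)

Definition adjacent (n : nat) (i j : 'I_n) : Prop :=
  i.+1 = j :> nat \/ j.+1 = i :> nat.

Definition upd (k n : nat) (f : 'I_k -> 'I_n) (a : 'I_k) (i : 'I_n) : 'I_k -> 'I_n :=
  fun x => if x == a then i else f x.
Arguments upd {k n} f a i x /.

(** Take the last [b] with [g b < f b]: for [y > b], [g b + 1 <= f b < f y <= g y], so there is room
    to raise [g b]. *)
Lemma increasing_raise (k n : nat) (f g : 'I_k -> 'I_n) (a : 'I_k) :
  increasing f -> increasing g -> (g a < f a)%N ->
  exists b (i : 'I_n), [/\ (g b < f b)%N, i = (g b).+1 :> nat &
    increasing (upd g b i)].
Proof.
move=> fi gi gfa.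
case: (arg_maxnP (P := fun b => (g b < f b)%N) (fun b => b : nat) gfa) => b gfb bmax.
have gbn : ((g b).+1 < n)%N by apply: leq_ltn_trans gfb (ltn_ord _).
exists b, (Ordinal gbn); split => // x y /=.
have [->|_] := eqVneq x b; have [->|_] := eqVneq y b => xy /=.
- by rewrite ltnn in xy.
- have : (f y <= g y)%N by rewrite leqNgt; apply/negP => /bmax /=; lia.
  by have := fi _ _ xy; lia.
- by have := gi _ _ xy; lia.
- exact: gi.
Qed.

(** Unit moves of single entries bring [f] and [g] together, lowering their l1 distance [d]; [P]
    must switch at one of these moves. *)
Lemma increasing_adjacent_switch (k n : nat) (P : pred ('I_k -> 'I_n)) f g :
  increasing f -> increasing g -> P f -> ~~ P g ->
  exists (h : 'I_k -> 'I_n) a i, [/\ increasing h, adjacent i (h a),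
    increasing (upd h a i), ~~ P h & P (upd h a i)].
Proof.
pose d (f g : 'I_k -> 'I_n) : nat := (\sum_(a < k) ((f a - g a) + (g a - f a)))%N.
have dC f' g' : d f' g' = d g' f' by apply: eq_bigr => a _; rewrite addnC.
have d_raise (f' g' : 'I_k -> 'I_n) b (i : 'I_n) :
    (g' b < f' b)%N -> i = (g' b).+1 :> nat -> (d f' (upd g' b i) < d f' g')%N.
  move=> gfb iE; rewrite /d (bigD1 b) //= [ltnRHS](bigD1 b) //= eqxx iE.
  rewrite -addSn leq_add //; first lia.
  by apply: leq_sum => a /negPf ->.
have back (h : 'I_k -> 'I_n) a i : upd (upd h a i) a (h a) = h.
  by apply/funext => x /=; case: eqVneq => [->|].
move: {2}(d f g) (leqnn (d f g)) => m; elim: m f g => [|m IH] f g dm fi gi Pf Pg.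
  suff fg : f = g by rewrite -fg Pf in Pg.
  apply/funext => a; apply/val_inj => /=.
  by move: dm; rewrite /d (bigD1 a) //=; lia.
have [/existsP[a gfa]|] := boolP [exists a, (g a < f a)%N].
  have [b [i [gfb iE g'i]]] := increasing_raise fi gi gfa.
  have [Pg'|Pg'] := boolP (P (upd g b i)).
    by exists g, b, i; split => //; right; rewrite iE.
  by apply: (IH f (upd g b i)) => //; have := d_raise _ _ _ _ gfb iE; lia.
rewrite negb_exists => /forallP gf.
have [/existsP[a gfa]|] := boolP [exists a, (f a < g a)%N].
  have [b [i [gfb iE g'i]]] := increasing_raise gi fi gfa.
  have [Pg'|Pg'] := boolP (P (upd f b i)).
    apply: (IH (upd f b i) g) => //; rewrite dC.
    by have := d_raise _ _ _ _ gfb iE; rewrite (dC g f); lia.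
  (* Here [P] is lost on raising [f], so the move is read backwards. *)
  exists (upd f b i), b, (f b); rewrite back; split => //=.
  by rewrite eqxx; left; rewrite iE.
rewrite negb_exists => /forallP fg.
suff fg' : f = g by rewrite -fg' Pf in Pg.
by apply/funext => a; apply/val_inj => /=; have := gf a; have := fg a; lia.
Qed.

Definition transvection (F : fieldType) (n : nat) (i j : 'I_n) (c : F) : 'M[F]_n :=
  1%:M + c *: delta_mx i j.

Lemma transvection_mulN (F : fieldType) (n : nat) (i j : 'I_n) (c : F) :
  i != j -> transvection i j c *m transvection i j (- c) = 1%:M.
Proof.
move=> ij; rewrite /transvection mulmxDl !mulmxDr !mul1mx mulmx1.
rewrite -scalemxAl -scalemxAr mul_delta_mx_0 1?eq_sym // !scaler0 addr0.
by rewrite scaleNr addrNK.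
Qed.

Lemma mulmx_transvection (F : fieldType) (k n : nat) (A : 'M[F]_(k, n))
    (i j : 'I_n) (c : F) a l :
  (A *m transvection i j c) a l = A a l + c * A a i *+ (l == j).
Proof.
rewrite mulmxDr mulmx1 mxE; congr (_ + _).
rewrite -scalemxAr mxE mxE (bigD1 i) //= big1 => [|x xi]; last first.
  by rewrite !mxE (negPf xi) mulr0.
by rewrite !mxE eqxx /= addr0 -mulrnAr; case: eqP; rewrite ?mulr1 ?mulr0.
Qed.

Lemma plucker_transvection0 (F : fieldType) (k n : nat) (A : 'M[F]_(k, n))
    (i j : 'I_n) (c : F) f :
  (forall a, f a != j) -> plucker (A *m transvection i j c) f = plucker A f.
Proof.
move=> fj; congr (\det _); apply/matrixP => a b.
by rewrite [LHS]mxE [RHS]mxE mulmx_transvection (negPf (fj b)) addr0.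
Qed.

(** Linearity of the determinant in column [a]; by injectivity of [f] the altered column is selected
    only once. *)
Lemma plucker_transvection (F : fieldType) (k n : nat) (A : 'M[F]_(k, n))
    (i : 'I_n) (c : F) f a :
  injective f ->
  plucker (A *m transvection i (f a) c) f =
    plucker A f + c * plucker A (upd f a i).
Proof.
move=> fi; move: (mulmx_transvection A i (f a) c); move: (A *m _) => A' A'E.
rewrite /plucker -det_tr -[\det (colsub f A)]det_tr.
rewrite -[\det (colsub _ A)]det_tr -[X in X + _]mul1r.
apply: (determinant_multilinear (i0 := a)).
- by apply/rowP => l; rewrite !mxE /= !eqxx A'E eqxx mulr1n mul1r.
- apply/matrixP => x y; rewrite !mxE A'E (inj_eq fi).
  by rewrite [lift a x == a]eq_sym (negPf (neq_lift _ _)) addr0.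
- apply/matrixP => x y; rewrite !mxE A'E (inj_eq fi) /=.
  by rewrite [lift a x == a]eq_sym (negPf (neq_lift _ _)) addr0.
Qed.

(** If [i] is already a value of [f], the minor has two equal columns; otherwise a move to a free
    neighbouring position passes no other value. *)
Lemma adjacent_increasing (F : fieldType) (k n : nat) (A : 'M[F]_(k, n))
    (i : 'I_n) f a :
  increasing f -> adjacent i (f a) ->
  increasing (upd f a i) \/ plucker A (upd f a i) = 0.
Proof.
move=> fi adj.
have [/existsP[b /eqP fb]|] := boolP [exists b, f b == i].
  right; rewrite /plucker -det_tr.
  have ab : a != b by apply/eqP => ab; move: adj; rewrite ab fb /adjacent; lia.
  apply: (determinant_alternate ab) => l.
  by rewrite !mxE /= eqxx [b == a]eq_sym (negPf ab) fb.
rewrite negb_exists => /forallP fNi; left=> x y xy /=.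
have vNi z : (f z != i :> nat) by apply: contra (fNi z) => /eqP/val_inj->.
have := fi _ _ xy; have := vNi x; have := vNi y.
move: adj; rewrite /adjacent.
by case: (eqVneq x a) => [->|_]; case: (eqVneq y a) => [->|_]; lia.
Qed.

Lemma small_sg_preserving (R : realType) (x y : R) :
  exists2 e : R, 0 < e & (x != 0 -> Num.sg (x - e * y) = Num.sg x).
Proof.
have [->|x0] := eqVneq x 0; first by exists 1.
(* The summand 1 keeps the denominator positive when [y = 0]; the perturbation stays below half of
   the absolute value of [x]. *)
pose e := `|x| / (2 * (1 + `|y|)).
have y1 : 0 < 1 + `|y| by rewrite ltr_pwDl.
have e0 : 0 < e by rewrite divr_gt0 ?normr_gt0 ?mulr_gt0.
exists e => // _.
have : `|e * y| < `|x|.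
  rewrite normrM (gtr0_norm e0) /e mulrAC ltr_pdivrMr ?mulr_gt0 //.
  rewrite ltr_pM2l ?normr_gt0 //; have := normr_ge0 y; lra.
case: (ltrgt0P x) x0 => // x0 _; rewrite ltr_norml => /andP[h1 h2].
  by rewrite !gtr0_sg //; lra.
by rewrite !ltr0_sg //; lra.
Qed.

(** Adding [e] times column [i] to column [j] adds to each minor through [j] a multiple of the one
    with [i] in place of [j], which by adjacency has the right sign or is zero. The inverse
    transpose acts on [v], changing only entry [i], and [e] is small enough to keep its sign. *)
Lemma nonneg_minors_perturb (R : realType) (k n : nat) (A : 'M[R]_(k, n))
    (s : R) (v : 'rV[R]_n) (i j : 'I_n) :
  s != 0 -> (forall f, increasing f -> 0 <= s * plucker A f) ->
  v *m A^T = 0 -> adjacent i j ->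
  exists (A' : 'M[R]_(k, n)) (v' : 'rV[R]_n),
  [/\ (forall f, increasing f -> 0 <= s * plucker A' f) /\ v' *m A'^T = 0,
      forall f, increasing f -> plucker A f != 0 -> plucker A' f != 0,
      forall f a, increasing f -> f a = j -> increasing (upd f a i) ->
        plucker A (upd f a i) != 0 -> plucker A' f != 0,
      forall l, v 0 l != 0 -> Num.sg (v' 0 l) = Num.sg (v 0 l) &
      v 0 j != 0 -> v' 0 i != 0].
Proof.
move=> s0 A0 vA adj.
have ij : i != j by apply/eqP => ij; move: adj; rewrite ij /adjacent; lia.
have [e e0 eP] := small_sg_preserving (v 0 i) (v 0 j).
pose A' := A *m transvection i j e.
pose v' := v *m (transvection i j (- e))^T.
have v'E l : v' 0 l = v 0 l - e * v 0 j *+ (l == i).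
  rewrite /v'; have -> : (transvection i j (- e))^T = transvection j i (- e).
    by rewrite /transvection linearD linearZ /= trmx1 trmx_delta.
  by rewrite mulmx_transvection mulNr mulNrn.
have A'E f a : increasing f -> f a = j ->
    plucker A' f = plucker A f + e * plucker A (upd f a i).
  by move=> fi fa; rewrite /A' -fa plucker_transvection //; apply: increasing_inj.
have ge0' f a : increasing f -> f a = j ->
    0 <= s * (e * plucker A (upd f a i)).
  move=> fi fa; rewrite mulrCA mulr_ge0 ?(ltW e0) //.
  have adj' : adjacent i (f a) by rewrite fa.
  by have [/A0//|->] := adjacent_increasing A fi adj'; rewrite mulr0.
have A'ge f : increasing f -> s * plucker A f <= s * plucker A' f.
  move=> fi; have [/existsP[a /eqP fa]|] := boolP [exists a, f a == j].
    by rewrite (A'E f a) // mulrDr lerDl ge0'.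
  by rewrite negb_exists => /forallP fj; rewrite plucker_transvection0.
have pos x : 0 <= s * x -> x != 0 -> 0 < s * x.
  by move=> sx x0; rewrite lt0r sx mulf_neq0.
exists A', v'; split.
- split=> [f fi|]; first by apply: le_trans (A'ge f fi); apply: A0.
  by rewrite /v' /A' trmx_mul -mulmxA [X in _ *m X]mulmxA -trmx_mul
    transvection_mulN // trmx1 mul1mx.
- move=> f fi /(pos _ (A0 f fi)) /lt_le_trans /(_ (A'ge f fi)) sA'.
  by apply: contraTneq sA' => ->; rewrite mulr0 ltxx.
- move=> f a fi fa f'i /(pos _ (A0 _ f'i)) sf'.
  have : 0 < s * plucker A' f.
    rewrite (A'E f a) // mulrDr [s * (e * _)]mulrCA.
    exact: ltr_wpDl (A0 f fi) (mulr_gt0 e0 sf').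
  by move=> sA'; apply: contraTneq sA' => ->; rewrite mulr0 ltxx.
- by move=> l; rewrite v'E; case: (eqVneq l i) => [->|_]; rewrite ?subr0.
- rewrite v'E eqxx mulr1n => vj; have [vi|vi] := eqVneq (v 0 i) 0.
    by rewrite vi sub0r oppr_eq0 mulf_neq0 // gt_eqF.
  by rewrite -sgr_eq0 eP // sgr_eq0.
Qed.

(** Induction on the number of zero minors plus zero entries of [v], which each perturbation lowers;
    with none left, [full_support_positive_minors] applies. *)
Lemma nonneg_minors_sign_variation (R : realType) (k n : nat)
    (A : 'M[R]_(k, n)) (s : R) (v : 'rV[R]_n) :
  s != 0 -> (forall f, increasing f -> 0 <= s * plucker A f) ->
  (exists2 f, increasing f & plucker A f != 0) ->
  v != 0 -> v *m A^T = 0 ->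
  exists w : 'rV[R]_n,
    [/\ forall i, w 0 i != 0,
        forall i, v 0 i != 0 -> Num.sg (w 0 i) = Num.sg (v 0 i) &
        (k <= var w)%N].
Proof.
move=> s0.
pose zA (A : 'M[R]_(k, n)) : {set {ffun 'I_k -> 'I_n}} :=
  [set f : {ffun _} | `[< increasing f >] && (plucker A f == 0)]%SET.
pose zv (v : 'rV[R]_n) : {set 'I_n} := [set i | v 0 i == 0]%SET.
have [m] := ubnP (#|zA A| + #|zv v|)%N.
elim: m A v => // m IH A v Am A0 [f fi f0] v0 vA.
have descend (A' : 'M[R]_(k, n)) (v' : 'rV[R]_n) :
    (forall f, increasing f -> 0 <= s * plucker A' f) -> v' *m A'^T = 0 ->
    (forall f, increasing f -> plucker A f != 0 -> plucker A' f != 0) ->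
    (forall l, v 0 l != 0 -> Num.sg (v' 0 l) = Num.sg (v 0 l)) ->
    (exists2 h, increasing h & plucker A h = 0 /\ plucker A' h != 0) \/
    (exists2 l, v 0 l = 0 & v' 0 l != 0) ->
    exists w : 'rV[R]_n,
    [/\ forall i, w 0 i != 0,
        forall i, v 0 i != 0 -> Num.sg (w 0 i) = Num.sg (v 0 i) &
        (k <= var w)%N].
  move=> A'0 v'A' A'n0 v'sg new.
  have v'n0 l : v 0 l != 0 -> v' 0 l != 0.
    by move=> vl; rewrite -sgr_eq0 v'sg // sgr_eq0.
  have sA : zA A' \subset zA A.
    apply/fintype.subsetP => g; rewrite !inE => /andP[gi]; rewrite gi /=.
    by apply: contraLR; apply: A'n0; apply/asboolP.
  have sv : zv v' \subset zv v.
    by apply/fintype.subsetP => l; rewrite !inE; apply: contraLR; apply: v'n0.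
  have [|||||w [w0 wsg wk]] := IH A' v' => //.
  - move: Am; rewrite ltnS; apply: leq_trans; case: new => [[h hi [h0 h'0]]|[l l0 l'0]].
      rewrite -addSn leq_add ?(subset_leq_card sv) // proper_card // properE sA /=.
      have hE : finfun h = h :> ('I_k -> 'I_n) by apply/funext => x; rewrite ffunE.
      apply/negP => /fintype.subsetP /(_ (finfun h)).
      rewrite !inE hE h0 eqxx (negPf h'0) andbT andbF.
      by move=> /(_ (introT (asboolP _) hi)).
    rewrite -addnS leq_add ?(subset_leq_card sA) // proper_card // properE sv /=.
    apply/negP => /fintype.subsetP /(_ l).
    by rewrite !inE l0 eqxx (negPf l'0) => /(_ isT).
  - by exists f => //; apply: A'n0.
  - by move/rV0Pn: v0 => [l vl]; apply/rV0Pn; exists l; apply: v'n0.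
  - by exists w; split=> // l vl; rewrite wsg ?v'sg // v'n0.
have [[g gi g0]|nA] := pselect (exists2 g, increasing g & plucker A g = 0).
  have [|h [a [i [hi adj h'i]]]] := increasing_adjacent_switch
    (P := fun f => plucker A f != 0) fi gi f0; first by rewrite g0 eqxx.
  rewrite negbK => /eqP h0 h'0.
  have [A' [v' [[A'0 v'A'] A'n0 A'new v'sg _]]] := nonneg_minors_perturb s0 A0 vA adj.
  apply: (descend A' v') => //; left; exists h => //; split=> //.
  exact: A'new h'i h'0.
have [[i vi]|nv] := pselect (exists i, v 0 i = 0).
  have /rV0Pn[j vj] := v0.
  (* Positions are viewed as maps from ['I_1], so the same switching lemma finds a zero entry of [v]
     next to a nonzero one. *)
  have inc1 (h : 'I_1 -> 'I_n) : increasing h by move=> a b; rewrite !ord1.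
  have [|h [a [l [_ adj _]]]] := increasing_adjacent_switch
    (P := fun f : 'I_1 -> 'I_n => v 0 (f 0) != 0) (inc1 (fun=> j)) (inc1 (fun=> i)) vj.
    by rewrite vi eqxx.
  rewrite ord1 negbK /= => /eqP vh vl.
  have adj' : adjacent (h 0) l by move: adj; rewrite ord1 /adjacent; lia.
  have [A' [v' [[A'0 v'A'] A'n0 _ v'sg v'new]]] := nonneg_minors_perturb s0 A0 vA adj'.
  apply: (descend A' v') => //; right; exists (h 0) => //; exact: v'new.
have vn0 i : v 0 i != 0 by apply/eqP => vi; apply: nv; exists i.
exists v; split=> //; apply: (full_support_positive_minors (A := A) (s := s)) => //.
  by have := leq_card _ (increasing_inj fi); rewrite !card_ord.
move=> g gi; rewrite lt0r A0 // mulf_neq0 //.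
by apply/eqP => g0; apply: nA; exists g.
Qed.

(** * Sign changes, twistor coordinates and the theorem *)

Lemma var_seq_map (R : realType) (T : Type) (f : T -> R) (e : seq T)
    (t := [seq i <- e | f i != 0]) :
  var_seq [seq f i | i <- e] =
  count (fun p => opposite_signs (f p.1) (f p.2)) (zip t (behead t)).
Proof.
rewrite /var_seq filter_map -/t behead_map.
have -> (s u : seq T) : zip (map f s) (map f u) = [seq (f p.1, f p.2) | p <- zip s u].
  by elim: s u => [|a s IH] [|b u] //=; rewrite IH.
by rewrite count_map.
Qed.

Lemma eq_sg_var (R : realType) (n : nat) (v w : 'rV[R]_n) :
  (forall i, Num.sg (v 0 i) = Num.sg (w 0 i)) -> var v = var w.
Proof.
move=> vw; rewrite /var !var_seq_map.
rewrite (eq_filter (a2 := fun i => w 0 i != 0)) => [|i].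
  apply: eq_count => p.
  by rewrite /opposite_signs -sgr_lt0 sgrM !vw -sgrM sgr_lt0.
by rewrite -sgr_eq0 vw sgr_eq0.
Qed.

(** Greedy choice: [y] is kept if its sign is opposite to that of [x]; otherwise the signs agree,
    and what alternates after [y] alternates after [x]. *)
Lemma alternating_subseq (R : realType) (T : eqType) (f : T -> R) x e k :
  all (fun i => f i != 0) (x :: e) ->
  (k <= count (fun p => opposite_signs (f p.1) (f p.2)) (zip (x :: e) e))%N ->
  exists t, [/\ subseq t e, size t = k &
    path (fun i j => opposite_signs (f i) (f j)) x t].
Proof.
elim: e x k => [|y e IH] x k /=.
  by move=> _; rewrite leqn0 => /eqP ->; exists [::].
case: k => [|k]; first by move=> _ _; exists [::].
move=> /and3P[x0 y0 e0]; rewrite -/(zip (y :: e) e).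
case xy: (opposite_signs (f x) (f y)) => [|] kc.
  have [|t [te tk pt]] := IH y k _ kc; first by rewrite /= y0.
  by exists (y :: t); rewrite /= eqxx xy te tk.
have [|t [te tk pt]] := IH y k.+1 _ kc; first by rewrite /= y0.
case: t te tk pt => // z t te tk pt.
exists (z :: t); split=> //; first exact: subseq_trans te (subseq_cons e y).
move: pt => /= /andP[yz ->]; rewrite andbT; move: yz xy.
rewrite /opposite_signs => yz /negbT; rewrite -leNgt => xy.
have : 0 < f x * f y by rewrite lt0r xy mulf_neq0.
move=> xy0; have : f x * f y * (f y * f z) < 0 by rewrite pmulr_rlt0.
have -> : f x * f y * (f y * f z) = f y ^+ 2 * (f x * f z) by ring.
have y2 : 0 < f y ^+ 2 by rewrite exprn_even_gt0.
by rewrite (pmulr_rlt0 _ y2).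
Qed.

Lemma var_alternating (R : realType) (k n : nat) (w : 'rV[R]_n) :
  (1 <= k)%N -> (k <= var w)%N ->
  exists (f : 'I_k.+1 -> 'I_n) (c : R),
    increasing f /\ forall a : 'I_k.+1, 0 < c * (-1) ^+ a * w 0 (f a).
Proof.
move=> k1; rewrite /var var_seq_map; set e := [seq i <- _ | _].
have e0 : all (fun i => w 0 i != 0) e by apply: filter_all.
have es : sorted (@ltord n) e.
  by apply: sorted_filter (sorted_enum_ord n); apply: ltord_trans.
case: e e0 es => [|x e] e0 es; first by rewrite /= leqNgt k1.
move=> /(alternating_subseq e0)[t [te tk pt]].
have tS : size (x :: t) == k.+1 by rewrite /= tk.
(* The scalar is the first nonzero entry of [w], so at [a = 0] the product is a square. *)
exists (tnth (Tuple tS)), (w 0 x); split.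
  apply: increasing_tnth; apply: subseq_sorted es; first exact: ltord_trans.
  by rewrite /= eqxx.
case=> a ak; rewrite (tnth_nth x) /=; elim: a ak => [|a IH] ak.
  rewrite /= mulr1 -expr2 exprn_even_gt0 //=; by case/andP: e0.
have := IH (ltnW ak); have := pathP x pt a.
have -> : (a < size t)%N by rewrite tk.
move=> /(_ isT); rewrite /opposite_signs; move: (nth x (x :: t) a) => i.
rewrite /= exprS; move: (nth x t a) => j lt1 lt2.
have : w 0 x * (-1) ^+ a * w 0 i * (w 0 i * w 0 j) < 0 by rewrite pmulr_rlt0.
have i0 : w 0 i != 0 by apply: contraTneq lt2 => ->; rewrite mulr0 ltxx.
have -> : w 0 x * (-1) ^+ a * w 0 i * (w 0 i * w 0 j) =
  w 0 i ^+ 2 * (w 0 x * (-1) ^+ a * w 0 j) by ring.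
have i2 : 0 < w 0 i ^+ 2 by rewrite exprn_even_gt0.
rewrite (pmulr_rlt0 _ i2) => lt3.
by rewrite mulN1r mulrN mulNr oppr_gt0.
Qed.

(** The matrix of the pairing [twistor]: it turns the Plücker coordinates of a hyperplane into a
    normal vector. *)
Definition alt_signs (F : fieldType) (k : nat) : 'M[F]_k.+1 :=
  diag_mx (\row_j (-1) ^+ (k - j)).

Lemma alt_signsK (F : fieldType) (k : nat) (p : 'rV[F]_k.+1) :
  p *m alt_signs F k *m alt_signs F k = p.
Proof.
apply/rowP => j; rewrite !mul_mx_diag !mxE -mulrA -exprD addnn.
by rewrite -signr_odd odd_double mulr1.
Qed.

Lemma twistorE (F : fieldType) (k : nat) (p v : 'rV[F]_k.+1) :
  twistor p v = (p *m alt_signs F k *m v^T) 0 0.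
Proof.
rewrite mxE; apply: eq_bigr => j _.
by rewrite mul_mx_diag !mxE [p 0 j * _]mulrC.
Qed.

Lemma twistor_vecE (R : realType) (k n : nat) (Z : 'M[R]_(n, k.+1))
    (x : proj R k) :
  twistor_vec Z x = hcoord x *m alt_signs R k *m Z^T.
Proof.
apply/rowP => i; rewrite mxE twistorE !mxE; apply: eq_bigr => j _.
by rewrite !mxE.
Qed.

(** Pairing with a row of [W] gives the determinant of [W] with that row repeated. *)
Lemma hat_minors_ker (F : fieldType) (k : nat) (W : 'M[F]_(k, k.+1)) :
  hat_minors W *m alt_signs F k *m W^T = 0.
Proof.
apply/rowP => a; rewrite [RHS]mxE.
have -> : (hat_minors W *m alt_signs F k *m W^T) 0 a = twistor (hat_minors W) (row a W).
  by rewrite twistorE !mxE; apply: eq_bigr => j _; rewrite !mxE.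
rewrite twistor_det.
have am : lift ord_max a != ord_max by rewrite eq_sym neq_lift.
by apply: (determinant_alternate am) => j; rewrite !mxE liftK unlift_none.
Qed.

(** The normal space of a hyperplane is a line, already spanned by the nonzero vector of signed
    minors. *)
Lemma ker_hat_minors (F : fieldType) (k : nat) (W : 'M[F]_(k, k.+1))
    (p : 'rV[F]_k.+1) :
  \rank W = k -> p *m alt_signs F k *m W^T = 0 ->
  exists c, p = c *: hat_minors W.
Proof.
move=> rW /sub_kermxP pK; have /sub_kermxP hK := hat_minors_ker W.
set q := p *m _ in pK; set h := _ *m alt_signs F k in hK.
have h0 : h != 0.
  apply: contraNneq (hat_minors_neq0 rW) => h0.
  by rewrite -[hat_minors W]alt_signsK -/h h0 mul0mx.
have rK : \rank (kermx W^T) = 1%N by rewrite mxrank_ker mxrank_tr rW subSnn.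
have Kh : (kermx W^T <= h)%MS.
  by rewrite -(mxrank_leqif_sup hK) rK rank_rV h0.
have /sub_rVP[c qc] := submx_trans pK Kh; exists c.
by rewrite -[p]alt_signsK -/q qc -scalemxAl alt_signsK.
Qed.

Lemma orthogonal_mx (F : fieldType) (k : nat) (u : 'rV[F]_k.+1) :
  u != 0 -> exists2 M : 'M[F]_(k, k.+1), \rank M = k & u *m M^T = 0.
Proof.
move=> u0; have rK : \rank (kermx u^T) = k.
  by rewrite mxrank_ker mxrank_tr rank_rV u0 subn1.
have := eq_row_base (kermx u^T); move: (row_base _); rewrite rK => M MK.
exists M; first by rewrite MK.
by apply: trmx_inj; rewrite trmx_mul trmxK trmx0; apply/sub_kermxP; rewrite MK.
Qed.

(* The maximal minors of a basis of the hyperplane orthogonal to [u] are, up to a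
   common factor, the [(-1)^j u_j]; extending by zero columns adds only zero minors. *)
Lemma orthogonal_same_sign (R : realType) (k n : nat) (v : 'rV[R]_n) :
  (1 <= k)%N -> (k <= var_bar v)%N ->
  exists A : 'M[R]_(k, n), [/\ \rank A = k, same_sign_minors A & v *m A^T = 0].
Proof.
move=> k1; have [[w vw <-] _] := var_barP v.
move=> /(var_alternating k1)[f [c [fi fw]]].
pose u0 : 'rV[R]_k.+1 := \row_a v 0 (f a).
have u0s (a : 'I_k.+1) : 0 <= c * (-1) ^+ a * u0 0 a.
  rewrite mxE; have [->|va] := eqVneq (v 0 (f a)) 0; first by rewrite mulr0.
  by rewrite -vw // ltW.
have c0 : c != 0.
  by apply: contraTneq (fw 0) => ->; rewrite !mul0r ltxx.
(* If [v] vanishes at all chosen indices, a multiple of the first unit vector replaces [u0] as the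
   normal vector. *)
have [u [un0 us uu]] : exists u : 'rV[R]_k.+1,
    [/\ u != 0, forall a : 'I_k.+1, 0 <= c * (-1) ^+ a * u 0 a & exists d, u0 = d *: u].
  have [u00|u0n] := eqVneq u0 0; last first.
    by exists u0; split=> //; exists 1; rewrite scale1r.
  exists (c *: delta_mx 0 0); split.
  - by rewrite scaler_eq0 negb_or c0; apply/rV0Pn; exists 0; rewrite mxE eqxx oner_eq0.
  - move=> a; rewrite !mxE eqxx /=; case: eqVneq => [->|_]; rewrite ?mulr0 //.
    by rewrite expr0 !mulr1 -expr2 sqr_ge0.
  - by exists 0; rewrite scale0r.
have [M rM uM] := orthogonal_mx un0.
(* [M *m E] places column [a] of [M] at position [f a] and zeros elsewhere. *)
pose E : 'M[R]_(k.+1, n) := \matrix_(a, i) (f a == i)%:R.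
have EE : E *m E^T = 1%:M.
  apply/matrixP => a b; rewrite !mxE (bigD1 (f a)) //= big1 => [|i ia].
    by rewrite !mxE eqxx mul1r addr0 (inj_eq (increasing_inj fi)) eq_sym.
  by rewrite !mxE [f a == i]eq_sym (negPf ia) mul0r.
have vE : v *m E^T = u0.
  apply/rowP => a; rewrite !mxE (bigD1 (f a)) //= big1 => [|i ia].
    by rewrite !mxE eqxx mulr1 addr0.
  by rewrite !mxE [f a == i]eq_sym (negPf ia) mulr0.
exists (M *m E); split.
- apply/eqP; rewrite eqn_leq rank_leq_row -{1}rM.
  rewrite -[M in X in (\rank X <= _)%N]mulmx1 -EE mulmxA.
  exact: mxrankM_maxl.
- have [d ud] : exists d, u *m alt_signs R k = d *: hat_minors M.
    by apply: ker_hat_minors rM _; rewrite alt_signsK.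
  have d0 : d != 0.
    apply: contraNneq un0 => d0; rewrite -[u]alt_signsK ud d0 scale0r.
    by rewrite mul0mx.
  (* The common sign comes from substituting [u_j = (-1)^(k-j) d m_j], with [m_j] the minor of [M]
     omitting column [j], into [0 <= c (-1)^j u_j]. *)
  suff sgM g : increasing g -> plucker (M *m E) g != 0 ->
      Num.sg (plucker (M *m E) g) = Num.sg (c * (-1) ^+ k * d).
    by move=> g h gi hi g0 h0; rewrite !sgM.
  move=> gi g0.
  (* A column outside the image of [f] is zero, so a nonzero minor selects columns through [f]
     only. *)
  have gf b : exists a, f a = g b.
    apply: contrapT => nf; case/eqP: g0.
    rewrite /plucker -det_tr (expand_det_row _ b) big1 // => l _.
    rewrite !mxE big1 ?mul0r // => a _; rewrite mxE.
    by case: eqP => [fg|]; rewrite ?mulr0 //; case: nf; exists a.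
  have [h hE] := boolp.choice gf.
  have hi : increasing h.
    move=> a b ab; rewrite ltnNge; apply/negP; rewrite leq_eqVlt => /predU1P[|/fi].
      move/val_inj => hab; have := gi _ _ ab.
      by rewrite -!hE hab ltnn.
    by rewrite !hE; have := gi _ _ ab; lia.
  have [j hj] := increasing_lift hi.
  have gM : plucker (M *m E) g = hat_minors M 0 j.
    rewrite mxE; congr (\det _); apply/matrixP => a b.
    rewrite !mxE (bigD1 (h b)) //= big1 => [|l lb].
      by rewrite !mxE hE eqxx mulr1 addr0 hj.
    by rewrite !mxE -hE (inj_eq (increasing_inj fi)) (negPf lb) mulr0.
  have := us j; rewrite gM in g0 *.
  have -> : u 0 j = (-1) ^+ (k - j) * (d * hat_minors M 0 j).
    have /rowP/(_ j) := ud; rewrite mul_mx_diag !mxE => <-.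
    by rewrite mulrCA -exprD addnn -signr_odd odd_double mulr1.
  have jk : (j <= k)%N by rewrite -ltnS.
  rewrite mulrA -[c * _ * _]mulrA -exprD subnKC // mulrA.
  set z := c * _ * d => zh.
  have z0 : z != 0 by rewrite !mulf_neq0 // signr_eq0.
  have : 0 < z * hat_minors M 0 j by rewrite lt0r zh mulf_neq0.
  case: (ltrgt0P z) z0 => // z0 _.
    by rewrite pmulr_rgt0 // => m0; rewrite !gtr0_sg.
  by rewrite nmulr_rgt0 // => m0; rewrite !ltr0_sg.
- rewrite trmx_mul mulmxA vE; have [d ->] := uu.
  by rewrite -scalemxAl uM scaler0.
Qed.

Lemma same_sign_minors_var_bar (R : realType) (k n : nat) (A : 'M[R]_(k, n))
    (v : 'rV[R]_n) :
  \rank A = k -> same_sign_minors A -> v != 0 -> v *m A^T = 0 ->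
  (k <= var_bar v)%N.
Proof.
move=> rA sA v0 vA; have [f fi f0] := ex_increasing_plucker_neq0 rA.
have [|g gi||//|//|w [w0 wv wk]] :=
  @nonneg_minors_sign_variation R k n A (Num.sg (plucker A f)) v.
- by rewrite sgr_eq0.
- have [->|g0] := eqVneq (plucker A g) 0; first by rewrite mulr0.
  by rewrite (sA f g) // -normrEsg.
- by exists f.
(* [w] has only the signs of [v] on its support; [w'] has the very entries of [v] there and still
   the signs of [w]. *)
pose w' : 'rV[R]_n := \row_i (if v 0 i == 0 then w 0 i else v 0 i).
apply: leq_trans wk _; rewrite (@eq_sg_var _ _ w w').
  by apply: (var_barP v).2 => i vi; rewrite mxE (negPf vi).
by move=> i; rewrite mxE; case: eqVneq => // vi; rewrite wv.
Qed.

Theorem theorem3p1 (R : realType) (k n : nat) (Z : 'M[R]_(n, k.+1))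
    (hk : (1 <= k)%N) (hn : (k + 1 <= n)%N) (hZ : \rank Z = k.+1)
    (hwd : Zmap_well_defined Z) :
  (@Gr_plucker R k) @` grasstope Z =
    [set x : proj R k | (k <= var_bar (twistor_vec Z x))%N].
Proof.
have Zfull : row_free Z^T by rewrite /row_free mxrank_tr hZ.
apply/seteqP; split => x /=.
  move=> [X [V V0 [A AV AX]] <-].
  have [h0 hx] := hcoordP (Gr_plucker X).
  have rA := represents_rank AV.
  apply: (same_sign_minors_var_bar rA); first exact/(Gr_ge0E AV).
    rewrite twistor_vecE; apply: contraNneq h0 => L0.
    rewrite -[hcoord _]alt_signsK; apply/eqP.
    by rewrite (row_free_inj Zfull (etrans L0 (esym (mul0mx _ _)))) mul0mx.
  (* Moving [Z] over to [A] reduces the claim to the normal vector of the row span of [A *m Z]. *)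
  rewrite twistor_vecE -[LHS]mulmxA -trmx_mul.
  have /vlineP[c ->] : hcoord (Gr_plucker X) \in <[hat_minors (A *m Z)]>%VS.
    by rewrite -(Gr_pluckerE AX) hx memv_line.
  by rewrite -!scalemxAl hat_minors_ker scaler0.
move=> /(orthogonal_same_sign hk)[A [rA sA]]; rewrite twistor_vecE => LA.
have dA : \dim (rowspan A) == k by rewrite dim_rowspan rA.
pose V : Gr R k n := exist _ (rowspan A) dA.
have AV : represents A V by [].
have rAZ : \rank (A *m Z) = k by apply: (hwd V) => //; apply/(Gr_ge0E AV).
have dAZ : \dim (rowspan (A *m Z)) == k by rewrite dim_rowspan rAZ.
pose X : Gr R k k.+1 := exist _ (rowspan (A *m Z)) dAZ.
exists X; first by exists V; [exact/(Gr_ge0E AV) | exists A].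
apply/val_inj; rewrite (@Gr_pluckerE _ _ X (A *m Z)) //.
have [h0 ->] := hcoordP x.
(* [A] annihilates the twistor vector, so the signed coordinates of [x] are normal to the row span
   of [A *m Z]. *)
have [c hc] : exists c, hcoord x = c *: hat_minors (A *m Z).
  by apply: ker_hat_minors rAZ _; rewrite trmx_mul mulmxA.
rewrite hc in h0 *; move: h0; rewrite scaler_eq0 negb_or => /andP[c0 _].
apply/eqP; rewrite eqEsubv -!memvE /= memvZ ?memv_line // andbT.
by apply/vlineP; exists c^-1; rewrite scalerA mulVf ?scale1r.
Qed.
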